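(* Suppose the model-based algorithm generated a game $(A,\mathbf B,\mathbf C,\mathbf Q^\infty,\mathbf R)$ with symmetric matrices $(X_1^\infty,\dots,X_N^\infty)$ such that $K_{i,d}C_i=R_{ii}^{-1}B_i^\top X_i^\infty$ for $i\in\mathcal N$; that is, $\mathbf Q^\infty=(Q_1^\infty,\dots,Q_N^\infty)$ is given by $$Q_i^\infty=-\sum_{j=1}^N(K_{j,d}C_j)^\top R_{ij}(K_{j,d}C_j)-A_{cl}^\top X_i^\infty-X_i^\infty A_{cl},\qquad A_{cl}=A-\sum_{j=1}^NB_jK_{j,d}C_j .$$ Then for any symmetric $Q_i'$ ($i\in\mathcal N$) and symmetric $R_{ij}'$ ($i,j\in\mathcal N$, $j\ne i$) satisfying $$(Q_i^\infty-Q_i')+\sum_{j=1,\,j\neq i}^N(K_{j,d}C_j)^\top(R_{ij}-R_{ij}')(K_{j,d}C_j)=0\quad\text{for all } i\in\mathcal N,$$ the game with cost parameters $Q_i'$, $R_{ij}'$ ($j\neq i$) and unchanged $R_{ii}'=R_{ii}$ also has $(K_{1,d},\dots,K_{N,d})$ as an output-feedback Nash equilibrium.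
   Context: Setting. $\mathcal N=\{1,\dots,N\}$; $A\in\mathbb R^{n\times n}$, $\mathbf B=(B_1,\dots,B_N)$ with $B_i\in\mathbb R^{n\times m_i}$, $\mathbf C=(C_1,\dots,C_N)$ with $C_i\in\mathbb R^{p_i\times n}$, $p_i<n$, each $C_i$ of full row rank, and $C_iB_i\neq0$. A square matrix is stable if all its eigenvalues have negative real part. A target tuple $(K_{1,d},\dots,K_{N,d})$, $K_{i,d}\in\mathbb R^{m_i\times p_i}$, with $A-\sum_jB_jK_{j,d}C_j$ stable is given. Games and equilibria. For symmetric $\mathbf Q=(Q_1,\dots,Q_N)$, $Q_i\in\mathbb R^{n\times n}$, and $\mathbf R=(R_{ij})_{i,j\in\mathcal N}$, $R_{ij}\in\mathbb R^{m_j\times m_j}$ symmetric, $R_{ii}>0$, the tuple $(A,\mathbf B,\mathbf C,\mathbf Q,\mathbf R)$ denotes the $N$-player differential game with dynamics $\dot x=Ax+\sum_iB_iu_i$, $x(0)=x_0$, outputs $y_i=C_ix$, controls $u_i=-K_iy_i$ with constant $K_i\in\mathbb R^{m_i\times p_i}$, and costs (to be minimized by player $i$) $$J_i(x_0,K_i,K_{-i})=\int_0^\infty\Big(x^\top Q_ix+\sum_{j=1}^Nu_j^\top R_{ij}u_j\Big)\,d\tau,$$ where $K_{-i}$ is the tuple of the other players' feedback matrices. Let $\mathcal K=\{(K_1,\dots,K_N): A-\sum_iB_iK_iC_i\text{ is stable}\}$. A tuple $(K_1^*,\dots,K_N^* )\in\mathcal K$ is an output-feedback Nash equilibrium if for every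 $i\in\mathcal N$, $J_i(x_0,K_i^*,K_{-i}^* )\le J_i(x_0,K_i,K_{-i}^* )$ for each $x_0$ and each $K_i$ such that $(K_1^*,\dots,K_{i-1}^*,K_i,K_{i+1}^*,\dots,K_N^* )\in\mathcal K$. Model-based algorithm. For fixed $\mathbf R$, the algorithm is an iterative procedure whose (limit) output consists of symmetric matrices $X_i^\infty$ with $R_{ii}^{-1}B_i^\top X_i^\infty=K_{i,d}C_i$ and of the matrices $Q_i^\infty$ computed from them by the formula displayed in the claim; only these properties of the output are used in the statement. *)

(* Defs.v *)
From HB Require Import structures.
From mathcomp Require Import all_boot all_order all_algebra.
From mathcomp Require Import all_classical all_reals all_analysis.
From mathcomp Require Import complex.

Set Implicit Arguments.
Unset Strict Implicit.
Unset Printing Implicit Defensive.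

Import Order.TTheory GRing.Theory Num.Theory.
Import numFieldNormedType.Exports.

Local Open Scope classical_set_scope.
Local Open Scope ring_scope.

Definition symmetric_mx (R : realType) (n : nat) (M : 'M[R]_n) : Prop :=
  M^T = M.

Definition qform (R : realType) (n : nat) (M : 'M[R]_n) (v : 'cV[R]_n) : R :=
  (v^T *m M *m v) 0 0.

Definition posdef_mx (R : realType) (n : nat) (M : 'M[R]_n) : Prop :=
  symmetric_mx M /\ forall v : 'cV[R]_n, v != 0 -> 0 < qform M v.

(* The eigenvalues of the real matrix [M] are its complex ones. *)
Definition stable_mx (R : realType) (n : nat) (M : 'M[R]_n) : Prop :=
  forall z : R[i], eigenvalue (map_mx (real_complex R) M) z ->
    complex.Re z < 0.

Section Game.
Variables (R : realType) (N n : nat) (m p : 'I_N -> nat).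

Definition inputs := forall i : 'I_N, 'M[R]_(n, m i).
Definition outputs := forall i : 'I_N, 'M[R]_(p i, n).
Definition feedbacks := forall i : 'I_N, 'M[R]_(m i, p i).
Definition state_weights := 'I_N -> 'M[R]_n.
(* In the weights [W i j], standing for R_ij, [i] is the player bearing the cost
   and [j] the one whose control is penalized. *)
Definition input_weights := forall i j : 'I_N, 'M[R]_(m j).

Variables (A : 'M[R]_n) (B : inputs) (C : outputs).

Definition closed_loop (K : feedbacks) : 'M[R]_n :=
  A - \sum_(j < N) B j *m K j *m C j.

Definition admissible (K : feedbacks) : Prop := stable_mx (closed_loop K).

Definition control (K : feedbacks) (x : R -> 'cV[R]_n) (j : 'I_N) (t : R) :
    'cV[R]_(m j) :=
  - (K j *m (C j *m x t)).

(* [x] solves x' = A x + \sum_j B_j u_j on [0, +oo[ with x(0) = x0; its values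
   at negative times are unconstrained. *)
Definition is_trajectory (x0 : 'cV[R]_n) (K : feedbacks)
    (x : R -> 'cV[R]_n) : Prop :=
  [/\ x 0 = x0,
      forall k : 'I_n, x t k 0 @[t --> 0^'+] --> x0 k 0
    & forall (t : R) (k : 'I_n), 0 < t ->
        is_derive t 1 (fun s => x s k 0)
          ((A *m x t + \sum_(j < N) B j *m control K x j t) k 0)].

(* A linear differential equation has exactly one solution on [0, +oo[, so the
   choice made by [xget] is immaterial there and its default is never used. *)
Definition trajectory (x0 : 'cV[R]_n) (K : feedbacks) : R -> 'cV[R]_n :=
  xget (fun=> 0) [set x | is_trajectory x0 K x].

(* The cost J_i(x0, K_i, K_{-i}), as a function of the whole tuple [K].
   The integral is absolutely convergent when [K] is admissible. *)
Definition cost (Q : state_weights) (W : input_weights) (i : 'I_N)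
    (x0 : 'cV[R]_n) (K : feedbacks) : \bar R :=
  let x := trajectory x0 K in
  (\int[lebesgue_measure]_(t in `[0%R, +oo[)
     (qform (Q i) (x t)
      + \sum_(j < N) qform (W i j) (control K x j t))%:E)%E.

(* [dfwith K i Ki] is [K] with its [i]-th component replaced by [Ki]. *)
Definition output_feedback_nash (Q : state_weights) (W : input_weights)
    (K : feedbacks) : Prop :=
  admissible K /\
  forall (i : 'I_N) (x0 : 'cV[R]_n) (Ki : 'M[R]_(m i, p i)),
    admissible (dfwith K i Ki) ->
    (cost Q W i x0 K <= cost Q W i x0 (dfwith K i Ki))%E.

End Game.

(* Main.v *)
(* Let F be the closed loop when only player i deviates from the target, with
   D = K_i C_i - K_{i,d} C_i.  The balance condition on (Q', R') and the formula
   for Q^oo turn the running cost of player i into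
     x^T (-(F^T X_i + X_i F)) x + (D x)^T R_ii (D x),
   whose first summand is -d/dt (x^T X_i x).  Since x decays exponentially, the
   cost is x0^T X_i x0 + \int (D x)^T R_ii (D x), minimal at D = 0.

   Exponential decay does not use a normal form of F: for a complex row q, the
   scalar function q x satisfies (q x)' = z (q x) + q (F - z) x, so q x decays
   if Re z < 0 and q (F - z) x does.  By Cayley-Hamilton the product of the F - z
   over the roots z of the characteristic polynomial vanishes, and one peels off
   the factors. *)
Require Import Defs.
From HB Require Import structures.
From mathcomp Require Import all_boot all_order all_algebra.
From mathcomp Require Import all_classical all_reals all_analysis.
From mathcomp Require Import measurable_realfun complex ring lra.

Set Implicit Arguments.
Unset Strict Implicit.
Unset Printing Implicit Defensive.

Import Order.TTheory GRing.Theory Num.Theory.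
Import numFieldNormedType.Exports.
Local Open Scope classical_set_scope.
Local Open Scope ring_scope.

(** * Existence of solutions of linear differential equations, by power series *)

Section LinearODE.
Variable R : realType.

Lemma succ_fact_inv k : k.+1%:R * (k.+1)`!%:R^-1 = k`!%:R^-1 :> R.
Proof. by rewrite factS natrM invfM mulVKf// pnatr_eq0. Qed.

(** Domination by the Taylor coefficients of [b * expR (a * t)]. This class gives an infinite radius
    of convergence and is stable under [pseries_diffs], so the series may be differentiated
    termwise. *)
Definition exp_bounded (c : R ^nat) := exists b a : R,
  [/\ 0 <= a, 0 <= b & forall k, `|c k| <= b * (a ^+ k / k`!%:R)].

Lemma exp_bounded_cvg (c : R ^nat) (t : R) :
  exp_bounded c -> cvgn (pseries c t).
Proof.
move=> [b [a [a0 b0 hc]]]; apply: normed_cvg.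
apply: (@series_le_cvg _ _ (fun k => b * exp_coeff (a * `|t|) k)) => [k|k|k|].
- exact: normr_ge0.
- by rewrite mulr_ge0// /exp_coeff/= divr_ge0// exprn_ge0// mulr_ge0.
- rewrite /= normrM normrX /exp_coeff/= exprMn.
  rewrite [_ ^+ k * _ / _]mulrAC mulrA ler_wpM2r ?exprn_ge0//.
- exact/is_cvg_seriesZ/is_cvg_series_exp_coeff.
Qed.

Arguments exp_bounded_cvg {c t}.

Lemma exp_bounded_diffs (c : R ^nat) :
  exp_bounded c -> exp_bounded (pseries_diffs c).
Proof.
move=> [b [a [a0 b0 hc]]]; exists (b * a), a; split=> // [|k].
  exact: mulr_ge0.
rewrite /pseries_diffs normrM ger0_norm// (le_trans (ler_wpM2l _ (hc _)))//.
rewrite le_eqVlt -(succ_fact_inv k) exprS; apply/orP; left; apply/eqP; ring.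
Qed.

(** The solution is the exponential series with terms F^k x0 t^k / k!, taken coordinate by
    coordinate. *)
Lemma linear_ode_solution (n : nat) (F : 'M[R]_n) (x0 : 'cV[R]_n) :
  exists x : R -> 'cV[R]_n, x 0 = x0 /\
    forall (t : R) (k : 'I_n), is_derive t 1 (fun s => x s k 0) ((F *m x t) k 0).
Proof.
pose v k : 'cV[R]_n := iter k (mulmx F) x0.
pose c i k : R := v k i 0 / k`!%:R.
(* The sum of all entries dominates every row sum, whence |(F^k x0)_i| <= b a^k by induction. *)
pose a := \sum_i \sum_j `|F i j|.
pose b := \sum_i `|x0 i 0|.
have a0 : 0 <= a by apply: sumr_ge0 => i _; apply: sumr_ge0.
have b0 : 0 <= b by apply: sumr_ge0.
have hv k i : `|v k i 0| <= b * a ^+ k.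
  elim: k i => [|k IH] i.
    by rewrite expr0 mulr1 /b (bigD1 i)//= lerDl sumr_ge0.
  rewrite /v iterS -/(v k) mxE (le_trans (ler_norm_sum _ _ _))//.
  rewrite (le_trans (_ : _ <= \sum_j `|F i j| * (b * a ^+ k)))//.
    by apply: ler_sum => j _; rewrite normrM ler_wpM2l.
  rewrite -mulr_suml exprS [leRHS]mulrCA ler_wpM2r//.
    by rewrite mulr_ge0 ?exprn_ge0.
  by rewrite /a [leRHS](bigD1 i)//= lerDl; apply: sumr_ge0 => l _; apply: sumr_ge0.
have hc i : exp_bounded (c i).
  exists b, a; split=> // k.
  by rewrite /c normrM normfV [`|_%:R|]ger0_norm// mulrA ler_wpM2r// invr_ge0.
have cv i t : cvgn (pseries (c i) t) by exact: exp_bounded_cvg.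
exists (fun t => \col_i limn (pseries (c i) t)); split.
  apply/colP => i; rewrite mxE; apply: cvg_lim => //.
  (* The shift discards the empty partial sum; at time 0 all the others equal [x0 i 0]. *)
  rewrite -cvg_shiftS/=; apply: cvg_near_cst; near=> k.
  rewrite /pseries /series/= big_nat_recl// expr0 mulr1 big1 ?addr0.
    by rewrite /c /v/= fact0 divr1.
  by move=> j _; rewrite expr0n/= mulr0.
move=> t k.
under eq_fun do rewrite mxE.
apply: is_derive_eq.
  apply: (@pseries_snd_diffs _ _ (`|t| + 1)) => //.
  - exact: (exp_bounded_cvg (exp_bounded_diffs (hc k))).
  - exact: (exp_bounded_cvg (exp_bounded_diffs (exp_bounded_diffs (hc k)))).
  - by rewrite [ltRHS]ger0_norm ?addr_ge0// ltrDl.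
rewrite mxE; apply: cvg_lim => //.
rewrite (_ : pseries _ t = fun l => \sum_j F k j * pseries (c j) t l).
  apply: cvg_big => [u w|j _]; [exact: add_continuous|rewrite mxE].
  by apply: cvgM; [exact: cvg_cst|exact: cv].
apply/funext => l; rewrite /pseries /series/=.
under [RHS]eq_bigr do rewrite mulr_sumr.
rewrite exchange_big; apply: eq_bigr => i _/=.
rewrite /pseries_diffs /c /v iterS -/(v i) mxE !mulr_suml mulr_sumr mulr_suml.
apply: eq_bigr => j _; rewrite -(succ_fact_inv i); ring.
Unshelve. all: by end_near. Qed.

End LinearODE.

(** * Exponentially decaying functions and a forced planar system *)

Section ExponentialDecay.
Variable R : realType.
Implicit Types (f g h u v : R -> R) (a b c t : R).

Definition exp_decay f := exists C c : R,
  [/\ 0 <= C, 0 < c & forall t, 0 <= t -> `|f t| <= C * expR (- c * t)].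

Lemma exp_decay0 : exp_decay (fun=> 0).
Proof. by exists 0, 1; split=> // t _; rewrite normr0 mul0r. Qed.

Lemma exp_decayD f g : exp_decay f -> exp_decay g -> exp_decay (fun t => f t + g t).
Proof.
move=> [C [c [C0 c0 hf]]] [D [d [D0 d0 hg]]].
exists (C + D), (Num.min c d); split=> [||t t0]; first exact: addr_ge0.
  by rewrite lt_min c0.
rewrite (le_trans (ler_normD _ _))// mulrDl lerD//.
  rewrite (le_trans (hf t t0))// ler_wpM2l// ler_expR ler_wpM2r// lerN2.
  by rewrite ge_min lexx.
rewrite (le_trans (hg t t0))// ler_wpM2l// ler_expR ler_wpM2r// lerN2.
by rewrite ge_min lexx orbT.
Qed.

Lemma exp_decayM f g : exp_decay f -> exp_decay g -> exp_decay (fun t => f t * g t).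
Proof.
move=> [C [c [C0 c0 hf]]] [D [d [D0 d0 hg]]].
exists (C * D), (c + d); split=> [||t t0]; [exact: mulr_ge0|exact: addr_gt0|].
rewrite normrM opprD mulrDl expRD mulrACA.
by apply: ler_pM => //; [exact: hf|exact: hg].
Qed.

Lemma exp_decayZ a f : exp_decay f -> exp_decay (fun t => a * f t).
Proof.
move=> [C [c [C0 c0 hf]]]; exists (`|a| * C), c; split=> [||t t0] //.
  exact: mulr_ge0.
by rewrite normrM -mulrA ler_wpM2l// hf.
Qed.

Lemma exp_decay_sum (I : Type) (r : seq I) (F : I -> R -> R) :
  (forall i, exp_decay (F i)) -> exp_decay (fun t => \sum_(i <- r) F i t).
Proof.
move=> hF; elim: r => [|i r IH].
  by under eq_fun do rewrite big_nil; exact: exp_decay0.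
by under eq_fun do rewrite big_cons; exact: exp_decayD.
Qed.

Lemma exp_decay_sqr f : exp_decay (fun t => f t ^+ 2) -> exp_decay f.
Proof.
move=> [C [c [C0 c0 hf]]]; exists (Num.sqrt C), (c / 2); split=> [||t t0].
- exact: sqrtr_ge0.
- by rewrite divr_gt0.
rewrite -(@ler_pXn2r _ 2) ?nnegrE ?mulr_ge0 ?sqrtr_ge0 ?expR_ge0//.
rewrite -normrX (le_trans (hf t t0))// exprMn sqr_sqrtr// expr2 -expRD.
by rewrite ler_wpM2l// ler_expR le_eqVlt; apply/orP; left; apply/eqP; field.
Qed.

Lemma is_derive_mul f g t df dg : is_derive t 1 f df -> is_derive t 1 g dg ->
  is_derive t 1 (fun s => f s * g s) (f t * dg + g t * df).
Proof. exact: is_deriveM. Qed.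

Lemma is_derive_expR_mul a t :
  is_derive t 1 (fun s => expR (a * s)) (a * expR (a * t)).
Proof.
have da : is_derive t 1 (fun s => a * s) a.
  by have := is_deriveZ a (is_derive_id t (1 : R)); rewrite /GRing.scale/= mulr1.
rewrite mulrC; exact: (is_derive1_comp (is_derive_expR (a * t)) da).
Qed.

Lemma continuous_expR_mul a : continuous (fun s => expR (a * s)).
Proof.
move=> t; apply: continuous_comp; last exact: continuous_expR.
by apply: cvgM; [exact: cvg_cst|exact: cvg_id].
Qed.

(** This is w' = (a + ib) w + (g + ih) for w = u + iv. The rotation terms in [b] cancel in the
    derivative of |w|^2, so only the damping [a] and the forcing matter. *)
Lemma exp_decay_ode (u v g h : R -> R) (a b : R) :
  continuous u -> continuous v -> a < 0 ->
  (forall t, 0 < t -> is_derive t 1 u (a * u t - b * v t + g t)) ->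
  (forall t, 0 < t -> is_derive t 1 v (b * u t + a * v t + h t)) ->
  exp_decay g -> exp_decay h -> exp_decay u /\ exp_decay v.
Proof.
move=> cu cv a0 du dv dg dh.
have [C [c [C0 c0 hC]]] := exp_decayD (exp_decayM dg dg) (exp_decayM dh dh).
pose s t := u t * u t + v t * v t.
suff : exp_decay s.
  move=> [D [d [D0 d0 hD]]]; split; apply: exp_decay_sqr;
    exists D, d; split=> // t t0; apply: le_trans (hD t t0);
    rewrite !ger0_norm ?addr_ge0 -?expr2 ?sqr_ge0// ?lerDl ?lerDr -?expr2 ?sqr_ge0//.
(* Completing squares gives s' <= a s + (g^2 + h^2) / (- a), and K is such that
   the function E below is nonincreasing. *)
pose d := Num.min c (- a / 2).
have d0 : 0 < d by rewrite lt_min c0 /=; lra.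
(* The bound [d <= c] lets the forcing be estimated at rate [d]; the bound by [- a / 2] keeps
   [- a - d] positive, as the denominator of [K] requires. *)
have dc : d <= c by rewrite ge_min lexx.
have da : d <= - a / 2 by rewrite ge_min lexx orbT.
pose K := C / (- a) / (- a - d).
have K0 : 0 <= K by rewrite !divr_ge0//; lra.
have s0 t : 0 <= s t by rewrite addr_ge0 -?expr2 ?sqr_ge0.
pose E t := expR (- a * t) * s t - K * expR ((- a - d) * t).
pose E' t := - a * expR (- a * t) * s t
  + expR (- a * t) * (2 * u t * (a * u t - b * v t + g t)
     + 2 * v t * (b * u t + a * v t + h t))
  - K * ((- a - d) * expR ((- a - d) * t)).
have dE t : 0 < t -> is_derive t 1 E (E' t).
  move=> t0; have d1 := du _ t0; have d2 := dv _ t0.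
  have e1 := is_derive_expR_mul (- a) t.
  have e2 := is_derive_expR_mul (- a - d) t.
  have ds : is_derive t 1 s (2 * u t * (a * u t - b * v t + g t)
     + 2 * v t * (b * u t + a * v t + h t)).
    refine (is_derive_eq (is_deriveD (is_derive_mul d1 d1) (is_derive_mul d2 d2)) _).
    by ring.
  refine (is_derive_eq (is_deriveB (is_derive_mul e1 ds) (is_deriveZ K e2)) _).
  by rewrite /E' /GRing.scale/=; ring.
have E'0 t : 0 < t -> E' t <= 0.
  move=> t0.
  have KE : K * (- a - d) = C / (- a) by rewrite /K divfK//; lra.
  have exE : expR ((- a - d) * t) = expR (- a * t) * expR (- d * t).
    by rewrite -expRD mulrDl.
  have -> : E' t = expR (- a * t) * (a * s t
      + 2 * (u t * g t + v t * h t) - C * expR (- d * t) / (- a)).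
    rewrite /E' mulrA KE exE /s; ring.
  rewrite pmulr_rle0 ?expR_gt0// subr_le0.
  have gh : g t * g t + h t * h t <= C * expR (- d * t).
    rewrite (le_trans (ler_norm _))// (le_trans (hC t (ltW t0)))//.
    by rewrite ler_wpM2l// ler_expR ler_wpM2r ?lerN2// ltW.
  rewrite ler_pdivlMr ?oppr_gt0// (le_trans _ gh)//.
  rewrite -subr_ge0.
  have -> : g t * g t + h t * h t
      - (a * s t + 2 * (u t * g t + v t * h t)) * - a
      = (a * u t + g t) ^+ 2 + (a * v t + h t) ^+ 2 by rewrite /s; ring.
  by rewrite addr_ge0// sqr_ge0.
have nE t : 0 <= t -> E t <= E 0.
  move=> t0; apply: (@ler0_derive1_nincry _ E 0) => // [x|x|].
  - by rewrite in_itv/= andbT => /dE[].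
  - rewrite in_itv/= andbT => x0; rewrite derive1E.
    by have -> := @derive_val _ _ _ _ _ _ _ (dE x x0); exact: E'0.
  - apply: continuous_subspaceT => x; apply: cvgB.
      apply: cvgM; first exact: continuous_expR_mul.
      by apply: cvgD; apply: cvgM; [exact: cu|exact: cu|exact: cv|exact: cv].
    by apply: cvgM; [exact: cvg_cst|exact: continuous_expR_mul].
exists (s 0 + K), d; split=> // [|t t0]; first exact: addr_ge0.
(* Unwinding [E t <= E 0] bounds [s t] by s(0) e^(at) + K e^(-dt), and e^(at) <= e^(-dt) because
   [d <= - a]. *)
have sE : s t = expR (a * t) * (expR (- a * t) * s t).
  by rewrite mulrA -expRD mulNr subrr expR0 mul1r.
rewrite ger0_norm// sE.
have := nE t t0; rewrite /E !mulr0 expR0 mul1r mulr1 => hE.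
have {}hE : expR (- a * t) * s t <= s 0 + K * expR ((- a - d) * t) by lra.
rewrite (le_trans (ler_wpM2l (expR_ge0 _) hE))// mulrDr [leRHS]mulrDl lerD//.
  rewrite mulrC ler_wpM2l// ler_expR ler_wpM2r//; lra.
by rewrite mulrCA -expRD -mulrDl addrA addrN add0r.
Qed.

End ExponentialDecay.

(** * Decay of the flow of a stable matrix *)

Section StableFlow.
Variable R : realType.

(** The equation is imposed only at positive times, since a trajectory frozen on the negative axis
    may have a corner at 0; continuity on the whole line takes care of that endpoint. *)
Definition linear_flow (n : nat) (F : 'M[R]_n) (x : R -> 'cV[R]_n) :=
  (forall k, continuous (fun t => x t k 0)) /\
  forall (t : R) (k : 'I_n), 0 < t ->
    is_derive t 1 (fun s => x s k 0) ((F *m x t) k 0).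

Lemma linear_flow_continuous_row n (F : 'M[R]_n) x (r : 'rV[R]_n) :
  linear_flow F x -> continuous (fun t => (r *m x t) 0 0).
Proof.
move=> [cx _]; under eq_fun do rewrite mxE; move=> t.
apply: cvg_big => [u|k _]; first exact: add_continuous.
by apply: cvgM; [exact: cvg_cst|exact: cx].
Qed.

Lemma linear_flow_derive_row n (F : 'M[R]_n) x (r : 'rV[R]_n) (t : R) :
  linear_flow F x -> 0 < t ->
  is_derive t 1 (fun s => (r *m x s) 0 0) ((r *m F *m x t) 0 0).
Proof.
move=> [_ dx] t0; under eq_fun do rewrite mxE.
have D k := is_deriveZ (r 0 k) (dx t k t0).
have := is_derive_sum D; rewrite fct_sumE => /is_derive_eq; apply.
by rewrite -mulmxA mxE.
Qed.

Definition exp_decay_row n (x : R -> 'cV[R]_n) (q : 'rV[R[i]]_n) :=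
  exp_decay (fun t => (map_mx (@complex.Re R) q *m x t) 0 0) /\
  exp_decay (fun t => (map_mx (@complex.Im R) q *m x t) 0 0).

(** The real and imaginary parts of q x solve the planar system of [exp_decay_ode] with a = Re z and
    b = Im z, forced by the parts of q (F - z) x. *)
Lemma linear_flow_decay_factor n (F : 'M[R]_n) x (q : 'rV[R[i]]_n) (z : R[i]) :
  linear_flow F x -> complex.Re z < 0 ->
  exp_decay_row x (q *m (map_mx (real_complex R) F - z%:M)) ->
  exp_decay_row x q.
Proof.
set G := _ - _ => fx z0 [dg dh].
have qG : q *m G = q *m map_mx (real_complex R) F - z *: q.
  by rewrite mulmxDr mulmxN mul_mx_scalar.
have reF : map_mx (@complex.Re R) q *m F = complex.Re z *: map_mx (@complex.Re R) q
    - complex.Im z *: map_mx (@complex.Im R) q + map_mx (@complex.Re R) (q *m G).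
  apply/rowP => j; rewrite qG !mxE raddfB /= raddf_sum /=.
  have -> : \sum_i complex.Re (q 0 i * map_mx (real_complex R) F i j)
      = \sum_i map_mx (@complex.Re R) q 0 i * F i j.
    by apply: eq_bigr => i _; rewrite !mxE; case: (q 0 i) => u v /=; ring.
  by case: z {z0 G dg dh qG} (q 0 j) => [a b] [u v] /=; ring.
have imF : map_mx (@complex.Im R) q *m F = complex.Im z *: map_mx (@complex.Re R) q
    + complex.Re z *: map_mx (@complex.Im R) q + map_mx (@complex.Im R) (q *m G).
  apply/rowP => j; rewrite qG !mxE raddfB /= raddf_sum /=.
  have -> : \sum_i complex.Im (q 0 i * map_mx (real_complex R) F i j)
      = \sum_i map_mx (@complex.Im R) q 0 i * F i j.
    by apply: eq_bigr => i _; rewrite !mxE; case: (q 0 i) => u v /=; ring.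
  by case: z {z0 G dg dh qG reF} (q 0 j) => [a b] [u v] /=; ring.
apply: (exp_decay_ode (b := complex.Im z) _ _ z0 _ _ dg dh).
- exact: (linear_flow_continuous_row (r := map_mx (@complex.Re R) q) fx).
- exact: (linear_flow_continuous_row (r := map_mx (@complex.Im R) q) fx).
- move=> t t0.
  have := linear_flow_derive_row (map_mx (@complex.Re R) q) fx t0.
  by rewrite reF !mulmxDl mulNmx -!scalemxAl => /is_derive_eq; apply; rewrite !mxE.
- move=> t t0.
  have := linear_flow_derive_row (map_mx (@complex.Im R) q) fx t0.
  by rewrite imF !mulmxDl -!scalemxAl => /is_derive_eq; apply; rewrite !mxE.
Qed.

Lemma stable_flow_decay n (F : 'M[R]_n) x :
  stable_mx F -> linear_flow F x -> forall k, exp_decay (fun t => x t k 0).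
Proof.
(* In dimension 0 there is no coordinate [k]; evaluating a polynomial at a matrix requires a
   positive size. *)
case: n F x => [F x _ _ []//|n F x sF fx k].
set FC := map_mx (real_complex R) F.
have [rs] := closed_field_poly_normal (char_poly FC).
rewrite (monicP (char_poly_monic FC)) scale1r => chE.
have rs0 z : z \in rs -> complex.Re z < 0.
  by move=> zrs; apply: sF; rewrite eigenvalue_root_char chE root_prod_XsubC.
(* The row [q] is generalized because peeling the root z replaces it by q (F - z). *)
have main (s : seq R[i]) (q : 'rV_n.+1) : {subset s <= rs} ->
    exp_decay_row x (q *m horner_mx FC (\prod_(z <- s) ('X - z%:P))) ->
    exp_decay_row x q.
  elim: s q => [|z s IH] q srs.
    by rewrite big_nil rmorph1 mulmx1.
  rewrite big_cons rmorphM /= rmorphB/= horner_mx_X horner_mx_C mulmxA => dq.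
  apply: (linear_flow_decay_factor fx (z := z)).
    by apply/rs0/srs; rewrite mem_head.
  by apply: IH => // w ws; apply: srs; rewrite inE ws orbT.
have [] : exp_decay_row x (delta_mx 0 k).
  apply: (main rs) => //; rewrite -chE Cayley_Hamilton mulmx0.
  suff e0 (f : R[i] -> R) : f 0 = 0 ->
      exp_decay (fun t => (map_mx f (0 : 'rV_n.+1) *m x t) 0 0).
    by split; exact: e0.
  move=> f0; rewrite (_ : map_mx f 0 = 0).
    by under eq_fun do rewrite mul0mx mxE; exact: exp_decay0.
  by apply/matrixP => i j; rewrite !mxE.
(* The basis row is real, so the real part of its product with the flow is the coordinate [k]
   itself. *)
move=> + _; congr exp_decay; apply/funext => t.
rewrite (_ : map_mx _ _ = delta_mx 0 k).
  by rewrite -rowE mxE.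
by apply/matrixP => i j; rewrite !mxE; case: (_ && _).
Qed.

End StableFlow.

(** * Improper integrals of exponentially decaying functions *)

Section Integrals.
Variable R : realType.
Local Notation mu := (@lebesgue_measure R).
Implicit Types f F : R -> R.

Lemma cvg_expR_mulNy (c : R) : 0 < c -> expR (- c * t) @[t --> +oo] --> (0 : R).
Proof.
move=> c0; under eq_fun do rewrite mulNr.
apply: (cvg_comp (fun t => c * t) (fun t => expR (- t))); last exact: cvgr_expR.
by apply: gt0_cvgMry => //; exact: cvg_id.
Qed.

Lemma exp_decay_cvg0 f : exp_decay f -> f t @[t --> +oo] --> (0 : R).
Proof.
move=> [C [c [C0 c0 hf]]].
have gC : C * expR (- c * t) @[t --> +oo] --> (0 : R).
  rewrite -(mulr0 C); apply: cvgM; [exact: cvg_cst|exact: cvg_expR_mulNy].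
apply: (@squeeze_cvgr _ _ _ _ (fun t => - (C * expR (- c * t)))
  (fun t => C * expR (- c * t))) => //.
  by near=> t; rewrite -ler_norml hf//.
by rewrite -oppr0; exact: cvgN.
Unshelve. all: by end_near. Qed.

Lemma measurable_EFin_continuous f (D : set R) :
  continuous f -> measurable_fun D (EFin \o f).
Proof.
move=> cf; apply/measurable_EFinP; apply: measurable_funTS.
exact: continuous_measurable_fun.
Qed.

Lemma integral_expR_mul (C c : R) : 0 <= C -> 0 < c ->
  (\int[mu]_(t in `[0%R, +oo[) (C * expR (- c * t))%:E)%E = (C / c)%:E.
Proof.
move=> C0 c0.
pose G t := - (C / c) * expR (- c * t).
have dG (t : R) : is_derive t 1 G (C * expR (- c * t)).
  refine (is_derive_eq (is_deriveZ (- (C / c)) (is_derive_expR_mul (- c) t)) _).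
  by rewrite /GRing.scale/=; field; rewrite gt_eqF.
have cG : continuous G.
  by move=> t; apply: cvgM; [exact: cvg_cst|exact: continuous_expR_mul].
rewrite (@ge0_continuous_FTC2y _ _ G 0 0).
- by rewrite /G mulr0 expR0 mulr1 -EFinB sub0r opprK.
- by move=> t _; rewrite mulr_ge0 ?expR_ge0.
- apply: continuous_subspaceT => t.
  by apply: cvgM; [exact: cvg_cst|exact: continuous_expR_mul].
- by rewrite -(mulr0 (- (C / c))); apply: cvgM; [exact: cvg_cst|exact: cvg_expR_mulNy].
- by move=> t _; case: (dG t).
- exact/cvg_at_right_filter/cG.
- by move=> t _; rewrite derive1E; exact: (@derive_val _ _ _ _ _ _ _ (dG t)).
Qed.

Lemma integrable_expR_mul (C c : R) : 0 <= C -> 0 < c ->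
  mu.-integrable `[0%R, +oo[ (EFin \o (fun t => C * expR (- c * t))).
Proof.
move=> C0 c0; apply/integrableP; split.
  apply: measurable_EFin_continuous => t.
  by apply: cvgM; [exact: cvg_cst|exact: continuous_expR_mul].
under eq_integral do rewrite /= ger0_norm ?mulr_ge0 ?expR_ge0//.
by rewrite integral_expR_mul// ltry.
Qed.

Lemma exp_decay_integrable f : continuous f -> exp_decay f ->
  mu.-integrable `[0%R, +oo[ (EFin \o f).
Proof.
move=> cf [C [c [C0 c0 hf]]].
apply: le_integrable (integrable_expR_mul C0 c0) => //.
  exact: measurable_EFin_continuous.
move=> t; rewrite /= in_itv/= andbT => t0.
by rewrite lee_fin (le_trans (hf t t0))// ler_norm.
Qed.

Lemma exp_decay_FTC2y f F : continuous f -> continuous F ->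
  exp_decay f -> exp_decay F ->
  (forall t : R, 0 < t -> is_derive t 1 F (f t)) ->
  (\int[mu]_(t in `[0%R, +oo[) (f t)%:E)%E = (- F 0)%:E.
Proof.
move=> cf cF df dF FE.
have fi := exp_decay_integrable cf df.
have [C [c [C0 c0 hf]]] := df.
have ei := integrable_expR_mul C0 c0.
(* Adding C e^(-ct) makes the integrand nonnegative, as the library's improper
   fundamental theorem of calculus requires. *)
pose G t := F t - (C / c) * expR (- c * t).
have cG : continuous G.
  move=> t; apply: cvgB; first exact: cF.
  by apply: cvgM; [exact: cvg_cst|exact: continuous_expR_mul].
have dG (t : R) : 0 < t -> is_derive t 1 G (f t + C * expR (- c * t)).
  move=> t0; refine (is_derive_eq (is_deriveB (FE t t0)
    (is_deriveZ (C / c) (is_derive_expR_mul (- c) t))) _).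
  by rewrite /GRing.scale/=; field; rewrite gt_eqF.
have : (\int[mu]_(t in `[0%R, +oo[) (f t + C * expR (- c * t))%:E)%E
    = (- F 0 + C / c)%:E.
  rewrite (@ge0_continuous_FTC2y _ _ G 0 0).
  - by rewrite /G mulr0 expR0 mulr1 -EFinB sub0r opprB addrC.
  - move=> t t0; have := hf t t0; rewrite ler_norml => /andP[+ _]; lra.
  - apply: continuous_subspaceT => t; apply: cvgD; first exact: cf.
    by apply: cvgM; [exact: cvg_cst|exact: continuous_expR_mul].
  - rewrite -[X in _ --> X](subr0 0); apply: cvgB; first exact: exp_decay_cvg0.
    rewrite -(mulr0 (C / c)); apply: cvgM; [exact: cvg_cst|exact: cvg_expR_mulNy].
  - by move=> t /dG[].
  - exact/cvg_at_right_filter/cG.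
  - move=> t; rewrite in_itv/= andbT => t0; rewrite derive1E.
    exact: (@derive_val _ _ _ _ _ _ _ (dG t t0)).
(* The added exponential has the finite integral C / c, which is cancelled from both sides once the
   integral of [f] is known to be finite. *)
under eq_integral do rewrite EFinD.
rewrite integralD//= integral_expR_mul// EFinD.
have /fineK <- : (\int[mu]_(t in `[0%R, +oo[) (f t)%:E)%E \is a fin_num.
  exact: integrable_fin_num fi.
by rewrite -!EFinD => -[] /addIr ->.
Qed.

End Integrals.

(** * Game trajectories as linear flows, and quadratic forms along them *)

Section Trajectories.
Variable R : realType.
Local Notation mu := (@lebesgue_measure R).

Lemma continuous_max0 (g : R -> R) :
  g t @[t --> 0^'+] --> g 0 -> (forall t : R, 0 < t -> {for t, continuous g}) ->
  continuous (fun t : R => g (Num.max t 0)).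
Proof.
move=> g0 cg t; case: (ltgtP t 0) => [t0|t0|->].
- apply/cvgrPdist_lt => e e0; near=> s.
  have s0 : s < 0 by near: s; exact: lt_nbhsl.
  by rewrite !max_r ?subrr ?normr0// ltW.
- apply: (@cvg_trans _ (g @ t)); last first.
    by rewrite max_l ?ltW//; exact: cg.
  apply: near_eq_cvg; near=> s.
  have s0 : 0 < s by near: s; exact: lt_nbhsr.
  by rewrite max_l// ltW.
- apply/cvgrPdist_lt => e e0.
  have /cvgrPdist_lt /(_ e e0) H := g0.
  (* By conversion, a property near 0 on the right is an implication holding on a full neighbourhood
     of 0. *)
  have {}H : \forall s \near nbhs (0 : R), 0 < s -> `|g 0 - g s| < e := H.
  near=> s; rewrite maxxx; case: (ltP s 0) => s0; first by rewrite subrr normr0.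
  move: s0; rewrite le_eqVlt => /predU1P[<-|s0]; first by rewrite subrr normr0.
  by move: s0; near: s.
Unshelve. all: by end_near. Qed.

Section Game.
Variables (N n : nat) (m p : 'I_N -> nat).
Variables (A : 'M[R]_n) (B : inputs R n m) (C : outputs R n p).

Lemma closed_loop_mul (K : feedbacks R m p) (x : R -> 'cV[R]_n) (t : R) :
  A *m x t + \sum_(j < N) B j *m control C K x j t = closed_loop A B C K *m x t.
Proof.
rewrite mulmxBl mulmx_suml -sumrN; congr (_ + _); apply: eq_bigr => j _.
by rewrite mulmxN !mulmxA.
Qed.

(** The power series solution shows that [xget] chooses from a nonempty set; its differentiability
    at 0 gives the right limit there. *)
Lemma trajectoryP (x0 : 'cV[R]_n) (K : feedbacks R m p) :
  is_trajectory A B C x0 K (trajectory A B C x0 K).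
Proof.
apply: xgetPex.
have [x [xx0 dx]] := linear_ode_solution (closed_loop A B C K) x0.
exists x; split=> // [k|t k t0]; last by rewrite closed_loop_mul.
rewrite -xx0; apply: cvg_at_right_filter.
have [d0 _] := dx 0 k.
by apply/differentiable_continuous/derivable1_diffP.
Qed.

(* Freezing the trajectory at negative times makes it continuous on the whole
   line, where [is_trajectory] leaves it unconstrained. *)
Lemma trajectory_flow (x0 : 'cV[R]_n) (K : feedbacks R m p) :
  linear_flow (closed_loop A B C K)
    (fun t => trajectory A B C x0 K (Num.max t 0)).
Proof.
have [xx0 x0r dx] := trajectoryP x0 K.
split=> [k|t k t0].
  apply: (continuous_max0 (g := fun t => trajectory A B C x0 K t k 0)).
    by rewrite xx0; exact: x0r.
  move=> t t0; have [d _] := dx t k t0.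
  by apply/differentiable_continuous/derivable1_diffP.
rewrite max_l ?(ltW t0)//.
have := dx t k t0; rewrite closed_loop_mul.
apply: near_eq_is_derive.
near=> s; have s0 : 0 < s by near: s; exact: lt_nbhsr.
by rewrite max_l// ltW.
Unshelve. all: by end_near. Qed.

End Game.

(** Products of coordinates and row functionals reduce continuity, derivatives and decay of a
    quadratic form to the facts on rows. *)
Lemma qform_sum n (M : 'M[R]_n) (v : 'cV[R]_n) :
  qform M v = \sum_i v i 0 * (row i M *m v) 0 0.
Proof.
rewrite /qform -mulmxA mxE; apply: eq_bigr => i _.
by rewrite mxE -row_mul [in RHS]mxE.
Qed.

Section Flow.
Variables (n : nat) (F : 'M[R]_n) (x : R -> 'cV[R]_n).
Hypothesis (fx : linear_flow F x).

Lemma linear_flow_continuous_qform (M : 'M[R]_n) :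
  continuous (fun t => qform M (x t)).
Proof.
under eq_fun do rewrite qform_sum.
move=> t; apply: cvg_big => [u|k _]; first exact: add_continuous.
by apply: cvgM; [exact: fx.1|exact: (linear_flow_continuous_row (r := row k M) fx)].
Qed.

Lemma linear_flow_derive_qform (M : 'M[R]_n) (t : R) : 0 < t ->
  is_derive t 1 (fun s => qform M (x s)) (qform (F^T *m M + M *m F) (x t)).
Proof.
move=> t0; under eq_fun do rewrite qform_sum.
have D k := is_derive_mul (fx.2 t k t0) (linear_flow_derive_row (row k M) fx t0).
have := is_derive_sum D; rewrite fct_sumE => /is_derive_eq; apply.
rewrite big_split /= /qform mulmxDr mulmxDl [RHS]mxE addrC; congr (_ + _).
  rewrite mulmxA -trmx_mul -[in RHS]mulmxA [RHS]mxE.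
  by apply: eq_bigr => i _; rewrite -row_mul mulrC [in RHS]mxE [X in _ * X = _]mxE mulrC.
rewrite -[in RHS]mulmxA [RHS]mxE.
by apply: eq_bigr => i _; rewrite -!row_mul [in RHS]mxE [X in _ * X = _]mxE.
Qed.

Hypothesis (sF : stable_mx F).

Lemma stable_flow_qform_decay (M : 'M[R]_n) : exp_decay (fun t => qform M (x t)).
Proof.
have dx := stable_flow_decay sF fx.
under eq_fun do rewrite qform_sum.
apply: exp_decay_sum => i; apply: exp_decayM => //.
under eq_fun do rewrite mxE.
by apply: exp_decay_sum => j; exact: exp_decayZ.
Qed.

Lemma stable_flow_qform_integrable (M : 'M[R]_n) :
  mu.-integrable `[0%R, +oo[ (EFin \o (fun t => qform M (x t))).
Proof.
by apply: exp_decay_integrable;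
  [exact: linear_flow_continuous_qform|exact: stable_flow_qform_decay].
Qed.

(** Lyapunov's identity: the integrand is the derivative of -x^T M x, which vanishes at infinity. *)
Lemma stable_flow_qform_integral (M : 'M[R]_n) :
  (\int[mu]_(t in `[0%R, +oo[) (qform (- (F^T *m M + M *m F)) (x t))%:E)%E
    = (qform M (x 0))%:E.
Proof.
rewrite -[qform M (x 0)]opprK.
apply: (exp_decay_FTC2y (F := fun t => - qform M (x t))).
- exact: linear_flow_continuous_qform.
- by move=> t; apply: cvgN; exact: linear_flow_continuous_qform.
- exact: stable_flow_qform_decay.
- have := exp_decayZ (-1) (stable_flow_qform_decay M).
  by under eq_fun do rewrite mulN1r.
- move=> t t0.
  refine (is_derive_eq (is_deriveN (linear_flow_derive_qform M t0)) _).
  by rewrite /qform mulmxN mulNmx [RHS]mxE.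
Qed.

End Flow.

End Trajectories.

(** * Positive definite matrices and completion of the square *)

Lemma posdef_mx_unit (R : realType) n (M : 'M[R]_n) :
  posdef_mx M -> M \in unitmx.
Proof.
move=> [_ pM]; rewrite -row_free_unit -kermx_eq0; apply/rowV0P => v /sub_kermxP vM.
apply/eqP/negPn/negP => v0.
have /pM : v^T != 0 by rewrite -trmx0 (inj_eq trmx_inj).
by rewrite /qform trmxK vM mul0mx mxE ltxx.
Qed.

Lemma qform_ge0 (R : realType) n (M : 'M[R]_n) (v : 'cV[R]_n) :
  posdef_mx M -> 0 <= qform M v.
Proof.
move=> [_ pM]; have [->|/pM/ltW//] := eqVneq v 0.
by rewrite /qform mulmx0 mxE.
Qed.

Lemma qformD (R : realType) n (M M' : 'M[R]_n) (v : 'cV[R]_n) :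
  qform (M + M') v = qform M v + qform M' v.
Proof. by rewrite /qform mulmxDr mulmxDl mxE. Qed.

Lemma qform_congr (R : realType) n k (M : 'M[R]_k) (D : 'M[R]_(k, n))
    (v : 'cV[R]_n) :
  qform (D^T *m M *m D) v = qform M (D *m v).
Proof. by rewrite /qform trmx_mul !mulmxA. Qed.

(** Here [L] is the target gain K_{i,d} C_i, [H] the deviating gain K_i C_i and [F] the resulting
    closed loop. Transposing [Wi *m L = Bi^T *m X] gives X B_i = L^T W_i, so the shift from [Acl] to
    [F] produces exactly the cross terms of the square. *)
Lemma completion_of_square (R : realType) n k (Acl X : 'M[R]_n) (Bi : 'M[R]_(n, k))
    (Wi : 'M[R]_k) (H L : 'M[R]_(k, n)) (F := Acl - Bi *m (H - L)) :
  X^T = X -> Wi^T = Wi -> Wi *m L = Bi^T *m X ->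
  - (L^T *m Wi *m L) - Acl^T *m X - X *m Acl + H^T *m Wi *m H =
  - (F^T *m X + X *m F) + (H - L)^T *m Wi *m (H - L).
Proof.
move=> sX sW WL.
have LW : X *m Bi = L^T *m Wi.
  by rewrite -[LHS]trmxK trmx_mul sX -WL trmx_mul sW.
have -> : F^T *m X = Acl^T *m X - (H - L)^T *m Wi *m L.
  by rewrite /F linearB/= trmx_mul mulmxBl -!mulmxA -WL.
have -> : X *m F = X *m Acl - L^T *m Wi *m (H - L).
  by rewrite /F mulmxBr mulmxA LW.
rewrite linearB/= !mulmxBr !mulmxBl.
apply/matrixP => a b; rewrite !mxE; ring.
Qed.

(** * The cost as the integral of one quadratic form, and the equilibrium *)

Section Cost.
Variables (R : realType) (N n : nat) (m p : 'I_N -> nat).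
Variables (A : 'M[R]_n) (B : inputs R n m) (C : outputs R n p).
Local Notation mu := (@lebesgue_measure R).

Definition cost_mx (Q : state_weights R N n) (W : input_weights R m) (i : 'I_N)
    (K : feedbacks R m p) : 'M[R]_n :=
  Q i + \sum_(j < N) (K j *m C j)^T *m W i j *m (K j *m C j).

Lemma cost_qform Q W i (x0 : 'cV[R]_n) (K : feedbacks R m p) :
  cost A B C Q W i x0 K =
  (\int[mu]_(t in `[0%R, +oo[)
     (qform (cost_mx Q W i K) (trajectory A B C x0 K (Num.max t 0)))%:E)%E.
Proof.
apply: eq_integral => t; rewrite inE/= in_itv/= andbT => t0.
rewrite max_l//; congr EFin.
set x := trajectory _ _ _ _ _ t.
rewrite qformD; congr (_ + _).
rewrite /qform mulmx_sumr mulmx_suml summxE; apply: eq_bigr => j _.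
by rewrite /control -/x mulmxN !linearN/= !mulNmx opprK !trmx_mul !mulmxA.
Qed.

End Cost.

Theorem mainTheorem3 (R : realType) (N n : nat) (m p : 'I_N -> nat)
  (A : 'M[R]_n) (B : inputs R n m) (C : outputs R n p)
  (hp : forall i : 'I_N, (p i < n)%N)
  (hC : forall i : 'I_N, row_free (C i))
  (hCB : forall i : 'I_N, C i *m B i != 0)
  (Kd : feedbacks R m p)
  (hKd : stable_mx (A - \sum_(j < N) B j *m Kd j *m C j))
  (W : input_weights R m)
  (hWsym : forall i j : 'I_N, symmetric_mx (W i j))
  (hWpos : forall i : 'I_N, posdef_mx (W i i))
  (Xinf Qinf : state_weights R N n)
  (hX : forall i : 'I_N, symmetric_mx (Xinf i))
  (hKX : forall i : 'I_N,
     Kd i *m C i = invmx (W i i) *m (B i)^T *m Xinf i)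
  (hQ : forall i : 'I_N,
     Qinf i = - (\sum_(j < N) (Kd j *m C j)^T *m W i j *m (Kd j *m C j))
              - (closed_loop A B C Kd)^T *m Xinf i
              - Xinf i *m closed_loop A B C Kd)
  (Q' : state_weights R N n) (W' : input_weights R m)
  (hQ' : forall i : 'I_N, symmetric_mx (Q' i))
  (hW' : forall i j : 'I_N, j != i -> symmetric_mx (W' i j))
  (hW'diag : forall i : 'I_N, W' i i = W i i)
  (hQW : forall i : 'I_N,
     (Qinf i - Q' i)
     + \sum_(j < N | j != i)
         (Kd j *m C j)^T *m (W i j - W' i j) *m (Kd j *m C j) = 0) :
  output_feedback_nash A B C Q' W' Kd.
Proof.
pose L j := Kd j *m C j; pose Acl := closed_loop A B C Kd.
have WL i : W i i *m L i = (B i)^T *m Xinf i.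
  by rewrite /L hKX !mulmxA mulmxV ?mul1mx//; exact: posdef_mx_unit.
(* Stated for every [K] agreeing with the target off player [i], so that it applies both to the
   deviation and to [Kd] itself. *)
have costE i K : (forall j, j != i -> K j = Kd j) ->
    let F := closed_loop A B C K in let D := K i *m C i - L i in
    cost_mx C Q' W' i K =
      - (F^T *m Xinf i + Xinf i *m F) + D^T *m W i i *m D.
  move=> KE /=.
  have FE : closed_loop A B C K = Acl - B i *m (K i *m C i - L i).
    rewrite /Acl /closed_loop (bigD1 i)//= [in RHS](bigD1 i)//=.
    rewrite (eq_bigr (fun j => B j *m Kd j *m C j)) => [|j /KE -> //].
    rewrite mulmxBr !mulmxA; apply/matrixP => a b; rewrite !mxE; ring.
  rewrite FE -(completion_of_square Acl (K i *m C i) (hX i) (hWsym i i) (WL i)).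
  rewrite /cost_mx (bigD1 i)//= hW'diag.
  rewrite (eq_bigr (fun j => (L j)^T *m W' i j *m L j)) => [|j /KE -> //].
  (* The balance condition exchanges Q' and the off-diagonal W' for Q^oo and W; the formula for Q^oo
     then cancels the weights of the other players. *)
  have := hQW i; rewrite hQ (bigD1 i)//= -/(L i) -/Acl.
  under [X in _ + X = 0]eq_bigr do rewrite mulmxBr mulmxBl.
  rewrite sumrB => e.
  apply/matrixP => a b; move/matrixP/(_ a b): e; rewrite !mxE; lra.
split=> [//|i x0 Ki adm].
set K := dfwith Kd i Ki in adm *.
have Kii : K i = Ki by rewrite /K dfwithin.
have Kij j : j != i -> K j = Kd j by move=> ji; rewrite /K dfwithout// eq_sym.
have cE := costE i K Kij; have cdE := costE i Kd (fun=> fun=> erefl).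
have flow := trajectory_flow A B C x0 K.
have [t0K _ _] := trajectoryP A B C x0 K.
have [t0d _ _] := trajectoryP A B C x0 Kd.
(* At the target D = 0, so its cost is x0^T X_i x0. *)
rewrite !cost_qform cE cdE subrr mulmx0 addr0.
rewrite (stable_flow_qform_integral (trajectory_flow A B C x0 Kd) hKd).
(* Both trajectories start at [x0], so this value is also a Lyapunov integral along the deviating
   one. The two integrands then differ pointwise by (D x)^T R_ii (D x) >= 0. *)
rewrite maxxx t0d -[X in qform _ X]t0K -[X in trajectory _ _ _ _ _ X](maxxx 0).
rewrite -(stable_flow_qform_integral flow adm).
apply: le_integral => //.
- exact: (stable_flow_qform_integrable flow adm).
- exact: (stable_flow_qform_integrable flow adm).
- move=> t _; rewrite lee_fin qformD lerDl qform_congr.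
  exact: qform_ge0.
Qed.
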